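(* Let $G$ be a finite set and let $\mathcal{P}=\{P_1,\dots,P_l\}$ be a collection of predicates $P_i\subseteq G^{k_i}$ with $k_{\min}=\min_i k_i\ge 3$ and $k_{\max}=\max_i k_i$, such that each $P_i$ supports a balanced pairwise independent distribution $\mu_i$. Let $(V,\mathcal{C})$ be an instance of CSP($\mathcal{P}$) that is $(s,2+\delta)$-boundary expanding for some $0<\delta\le\frac14$. Then there exists a balanced solution to $\frac{\delta s}{6k_{\max}}$ rounds of the Sherali-Adams hierarchy that satisfies every constraint in $\mathcal{C}$.
   Context: An instance $(V,\mathcal{C})$ of CSP($\mathcal{P}$) consists of a set $V$ of variables taking values in $G$ and constraints $C_1,\dots,C_m$, each $C_i$ given by a type $t_i\in\{1,\dots,l\}$ and a tuple $E_i=(e_{i,1},\dots,e_{i,k_{t_i}})$ of distinct variables; an assignment $f:V\to G$ satisfies $C_i$ iff $(f(e_{i,1}),\dots,f(e_{i,k_{t_i}}))\in P_{t_i}$ (no shifts of predicates are implicitly allowed). The instance is $(s,\alpha)$-boundary expanding if for every set of $s'\le s$ constraints $C_{i_1},\dots,C_{i_{s'}}$, the number of variables appearing in exactly one of $E_{i_1},\dots,E_{i_{s'}}$ is at least $\sum_j |E_{i_j}| - \alpha s'$. A distribution $\mu$ on $G^k$ is balanced if $\Pr_{x\sim\mu}[x_i=g]=1/|G|$ for all $i,g$, and balanced pairwise independent if moreover $\Pr[x_i=g,x_j=g']=1/|G|^2$ for all $i\ne j$ and $g,g'\in G$; $P$ supports $\mu$ if $\mu$ is supported in $P$. A $t$-local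 distribution is a collection $\{X_S(\alpha)\in[0,1]\}$, $S\subseteq V$, $|S|\le t$, $\alpha:S\to G$, with $X_\emptyset=1$ and $\sum_{\beta:T\setminus S\to G}X_T(\alpha\circ\beta)=X_S(\alpha)$ for all $S\subseteq T\subseteq V$, $|T|\le t$, $\alpha:S\to G$. A solution to $t$ rounds of the Sherali-Adams hierarchy is a $t$-local distribution; it satisfies $C_i$ if $X_{E_i}(\alpha)=0$ whenever $(\alpha(e_{i,1}),\dots,\alpha(e_{i,k_{t_i}}))\notin P_{t_i}$; it is balanced if $X_{\{v\}}(v\mapsto g)=1/|G|$ for all $v\in V$, $g\in G$. *)

(* Defs.v *)
From HB Require Import structures.
From mathcomp Require Import all_boot all_order all_algebra.
From mathcomp Require Import reals.

Set Implicit Arguments.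
Unset Strict Implicit.
Unset Printing Implicit Defensive.

Import Order.TTheory GRing.Theory Num.Theory.
Local Open Scope ring_scope.

Section Distributions.
Variables (R : realType) (G : finType) (k : nat).
Implicit Types (mu : k.-tuple G -> R) (P : {set k.-tuple G}).

Definition is_distribution mu : Prop :=
  (forall x, 0 <= mu x) /\ \sum_x mu x = 1.

Definition prob mu (A : pred (k.-tuple G)) : R := \sum_(x | A x) mu x.

Definition balanced_distribution mu : Prop :=
  forall (i : 'I_k) (g : G), prob mu (fun x => tnth x i == g) = #|G|%:R^-1.

Definition balanced_pairwise_independent mu : Prop :=
  balanced_distribution mu /\
  forall (i j : 'I_k) (g g' : G), i != j ->
    prob mu (fun x => (tnth x i == g) && (tnth x j == g'))
      = (#|G|%:R ^+ 2)^-1.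

Definition supports P mu : Prop := forall x, x \notin P -> mu x = 0.

End Distributions.

Section Arities.
Variables (l : nat) (k : 'I_l -> nat).

Definition k_max : nat := \max_(i < l) k i.

(* For [0 < l] this is the minimum of the [k i]; since no [k i] exceeds
   [k_max], the starting value does not affect it. *)
Definition k_min : nat := \big[minn/k_max]_(i < l) k i.

(* The constraints form a finite family, so a set of constraints is a set of
   indices, and two indices may carry the same constraint. *)
Record csp_instance (V : finType) := CspInstance {
  nb_constraints : nat;
  ctype : 'I_nb_constraints -> 'I_l;
  scope : forall i, (k (ctype i)).-tuple V;
  scope_uniq : forall i, uniq (scope i) }.

End Arities.

Section BoundaryExpansion.
Variables (R : realType) (l : nat) (k : 'I_l -> nat) (V : finType).
Variable (Phi : csp_instance k V).

Definition vars (i : 'I_(nb_constraints Phi)) : {set V} :=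
  [set v in scope i].

Definition boundary (I : {set 'I_(nb_constraints Phi)}) : {set V} :=
  [set v | #|[set i in I | v \in vars i]| == 1%N].

Definition boundary_expanding (s a : R) : Prop :=
  forall I : {set 'I_(nb_constraints Phi)}, #|I|%:R <= s ->
    \sum_(i in I) #|vars i|%:R - a * #|I|%:R <= #|boundary I|%:R.

End BoundaryExpansion.

Section LocalDistributions.
Variables (R : realType) (G V : finType).

Definition partial_assignment (S : {set V}) : predArgType :=
  {ffun {v : V | v \in S} -> G}.

Lemma in_setD_intro (S T : {set V}) (v : V) :
  v \in T -> v \notin S -> v \in T :\: S.
Proof. by move=> vT vS; rewrite inE vS. Qed.

(* [alpha] on [S] and [beta] on [T :\: S], glued into an assignment on [T]. *)
Definition glue (S T : {set V}) (alpha : partial_assignment S)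
    (beta : partial_assignment (T :\: S)) : partial_assignment T :=
  [ffun v => match boolP (sval v \in S) with
             | AltTrue vS => alpha (exist _ (sval v) vS)
             | AltFalse vS =>
                 beta (exist _ (sval v) (in_setD_intro (svalP v) vS))
             end].

(* The family is indexed by all subsets of [V], but for [0 <= t] the conditions
   below constrain only its values at sets of size at most [t]; the others are
   junk. The bound [t] is real and need not be an integer. *)
Definition local_family := forall S : {set V}, partial_assignment S -> R.

Definition local_distribution (t : R) (X : local_family) : Prop :=
  [/\ forall (S : {set V}) (alpha : partial_assignment S),
        #|S|%:R <= t -> 0 <= X S alpha <= 1,
      forall alpha : partial_assignment set0, X set0 alpha = 1
    & forall (S T : {set V}) (alpha : partial_assignment S),
        S \subset T -> #|T|%:R <= t ->
        \sum_(beta : partial_assignment (T :\: S)) X T (glue alpha beta)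
          = X S alpha].

Definition balanced_solution (t : R) (X : local_family) : Prop :=
  forall v : V, #|[set v]|%:R <= t ->
    forall g : G, X [set v] [ffun=> g] = #|G|%:R^-1.

Variables (l : nat) (k : 'I_l -> nat) (P : forall i, {set (k i).-tuple G}).
Variable (Phi : csp_instance k V).

Lemma tnth_vars (i : 'I_(nb_constraints Phi)) (j : 'I_(k (ctype i))) :
  tnth (scope i) j \in vars i.
Proof. by rewrite inE mem_tnth. Qed.

Definition scope_values (i : 'I_(nb_constraints Phi))
    (alpha : partial_assignment (vars i)) : (k (ctype i)).-tuple G :=
  [tuple alpha (exist _ (tnth (scope i) j) (tnth_vars j))
     | j < k (ctype i)].

Definition satisfies_constraint (t : R) (X : local_family)
    (i : 'I_(nb_constraints Phi)) : Prop :=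
  #|vars i|%:R <= t ->
  forall alpha : partial_assignment (vars i),
    scope_values alpha \notin P (ctype i) -> X (vars i) alpha = 0.

End LocalDistributions.

(* Main.v *)
(* Give each constraint the density [#|G| ^ k_i * mu_i] against the uniform
   measure on total assignments. If at most two variables of a constraint are
   shared with the other constraints of a family or lie in [S], averaging over
   its remaining variables turns its density into 1, by pairwise independence;
   so the constraint can be peeled off without changing the marginal on [S].
   Each [S] gets a small set of constraints [A] maximising a potential, chosen
   so that every moderately larger set peels down to [A]; the local
   distribution on [S] is the marginal of the product of the densities in [A].
   For [S] included in [T], the sets chosen for [S] and [T] have the same
   marginals as their union, which gives consistency. *)
Require Import Defs.
From HB Require Import structures.
From mathcomp Require Import all_boot all_order all_algebra.
From mathcomp Require Import boolp reals.
From mathcomp Require Import ring lra zify.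

Set Implicit Arguments.
Unset Strict Implicit.
Unset Printing Implicit Defensive.

Import Order.TTheory GRing.Theory Num.Theory.
Local Open Scope ring_scope.

(** * Resampling a total assignment on a set of variables *)

Section Resampling.
Variables (V G : finType).
Implicit Types (f h y : {ffun V -> G}) (U S K : {set V}).

Definition resample U f h : {ffun V -> G} :=
  [ffun v => if v \in U then h v else f v].

Definition determined_by (T : Type) S (H : {ffun V -> G} -> T) : Prop :=
  forall f h, {in S, f =1 h} -> H f = H h.

(** The product form avoids the truncated exponent [#|V| - #|K|]. *)
Lemma card_agree K y :
  (#|[set f : {ffun V -> G} | [forall v in K, f v == y v]]| * #|G| ^ #|K|
     = #|G| ^ #|V|)%N.
Proof.
pose F v := if v \in K then pred1 (y v) else predT.
have -> : #|[set f : {ffun V -> G} | [forall v in K, f v == y v]]|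
    = #|(family F : pred {ffun V -> G})|.
  apply: eq_card => f; rewrite inE; apply/forall_inP/familyP => fK v.
    by rewrite /F; case: ifP => // vK; rewrite inE fK.
  by move=> vK; have := fK v; rewrite /F vK inE.
rewrite card_family foldrE big_map big_enum /=.
rewrite -(prod_nat_const (mem K)) [X in (_ * X)%N]big_mkcond -big_split /=.
rewrite -prod_nat_const; apply: eq_bigr => v _; rewrite /F.
by case: ifP => _; rewrite ?card1 ?mul1n ?muln1.
Qed.

(** Exchanging the values of [f] and [h] on [U] is an involution on pairs, and [resample U f h] is
    the first component of its image. *)
Lemma sum_resample (R : comNzRingType) U (F : {ffun V -> G} -> R) :
  \sum_f \sum_h F (resample U f h) = (#|G| ^ #|V|)%:R * \sum_f F f.
Proof.
pose swap p := (resample U p.1 p.2, resample U p.2 p.1).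
have swapK : involutive swap.
  move=> [f h]; rewrite /swap /=; congr (_, _);
    by apply/ffunP => v; rewrite !ffunE; case: (v \in U).
rewrite pair_bigA (reindex_inj (inv_inj swapK)) /=.
transitivity (\sum_(p : {ffun V -> G} * {ffun V -> G}) F p.1).
  apply: eq_bigr => -[f h] _; congr F; apply/ffunP => v /=.
  by rewrite !ffunE; case: (v \in U).
rewrite -(pair_bigA _ (fun f _ => F f)) /= mulr_sumr.
by apply: eq_bigr => f _; rewrite sumr_const card_ffun mulr_natl.
Qed.

Variables (k : nat) (e : k.-tuple V).
Hypothesis e_uniq : uniq e.

Lemma card_fixed_positions U :
  U \subset [set v in e] ->
  #|[set j | tnth e j \notin U]| = #|[set v in e] :\: U|.
Proof.
move=> Ue; have e_inj : injective (tnth e) by apply/tuple_uniqP.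
rewrite -(card_imset _ e_inj); apply: eq_card => v; rewrite !inE.
apply/imsetP/andP => [[j] |[vU /tnthP[j vE]]].
  by rewrite inE => jU ->; rewrite mem_tnth.
by exists j; rewrite // inE -vE.
Qed.

(** Positions outside [U] keep the values of [f], so [x] must agree with [f] there; then [h] is
    forced on [U] and free elsewhere. *)
Lemma card_resample_eq U f (x : k.-tuple G) :
  U \subset [set v in e] ->
  (#|[set h | map_tuple (resample U f h) e == x]| * #|G| ^ #|U|
    = if [forall j in [set j | tnth e j \notin U], tnth x j == f (tnth e j)]
      then #|G| ^ #|V| else 0)%N.
Proof.
move=> /subsetP Ue; case: ifPn => [/forall_inP xf|xNf]; last first.
  rewrite (_ : [set h | _] = set0) ?cards0 //.
  apply/setP => h; rewrite !inE; apply: contraNF xNf => /eqP <-.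
  by apply/forall_inP => j; rewrite inE tnth_map ffunE => /negbTE ->.
have [y ye] : exists y : {ffun V -> G}, forall j, y (tnth e j) = tnth x j.
  (* The default [f v] is reached only off [e], where the value of [y] does not matter. *)
  exists [ffun v => nth (f v) x (index v e)] => j.
  have ij : index (tnth e j) e = j.
    by rewrite {1}(tnth_nth (tnth e j)) index_uniq ?size_tuple.
  by rewrite ffunE ij -tnth_nth.
rewrite -(card_agree U y); congr (_ * _)%N; apply: eq_card => h.
rewrite !inE; apply/eqP/forall_inP => [hx v vU|hy].
  have := Ue v vU; rewrite inE => /tnthP[j vE].
  by rewrite vE ye -hx tnth_map ffunE -vE vU.
apply: eq_from_tnth => j; rewrite tnth_map ffunE; case: ifPn => [/hy/eqP->|jU].
  exact: ye.
by apply/esym/eqP/xf; rewrite inE.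
Qed.

End Resampling.

(** * Averaging a constraint density by pairwise independence *)

Section PairwiseIndependence.
Variables (R : realType) (G : finType) (k : nat) (mu : k.-tuple G -> R).
Hypotheses (mu_dist : is_distribution mu).
Hypotheses (mu_pi : balanced_pairwise_independent mu).
Hypotheses (G_gt0 : (0 < #|G|)%N).

(** The sizes 0, 1 and 2 of [J] are total mass, balance and pairwise independence respectively. *)
Lemma marginal_le2 (J : {set 'I_k}) (a : 'I_k -> G) :
  (#|J| <= 2)%N ->
  prob mu (fun x => [forall j in J, tnth x j == a j]) * #|G|%:R ^+ #|J| = 1.
Proof.
have N0 : #|G|%:R != 0 :> R by rewrite pnatr_eq0 -lt0n.
have [mu_bal mu_ind] := mu_pi.
case J2: #|J| => [|[|[|//]]] _.
- rewrite expr0 mulr1 -mu_dist.2; apply: eq_bigl => x.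
  apply/forall_inP => j; have/eqP := J2; rewrite cards_eq0 => /eqP ->.
  by rewrite inE.
- have /eqP/cards1P[j ->] := J2.
  rewrite expr1 -[RHS](mulVf N0) -(mu_bal j (a j)); congr (_ * _).
  apply: eq_bigl => x; apply/forall_inP/idP => [|xj i].
    by apply; rewrite inE.
  by rewrite inE => /eqP ->.
have /eqP/cards2P[i [j [ij ->]]] := J2.
rewrite -[RHS](mulVf (expf_neq0 2 N0)) -(mu_ind i j (a i) (a j) ij).
congr (_ * _); apply: eq_bigl => x; apply/forall_inP/andP => [xa|[xi xj] i'].
  by split; apply: xa; rewrite !inE eqxx ?orbT.
by rewrite !inE => /orP[] /eqP ->.
Qed.

Variables (V : finType) (e : k.-tuple V).
Hypothesis e_uniq : uniq e.

(** Grouping the [h] by the tuple read along [e] leaves the marginal of [mu] on the at most two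
    positions outside [U]. That marginal is uniform, and the factor [#|G| ^ k] normalises it. *)
Lemma sum_resample_constraint (U : {set V}) (f : {ffun V -> G}) :
  U \subset [set v in e] -> (#|[set v in e] :\: U| <= 2)%N ->
  \sum_h #|G|%:R ^+ k * mu (map_tuple (resample U f h) e)
    = (#|G| ^ #|V|)%:R.
Proof.
move=> Ue U2; have N0 : #|G|%:R != 0 :> R by rewrite pnatr_eq0 -lt0n.
have cardk : (#|U| + #|[set v in e] :\: U| = k)%N.
  have := cardsID U [set v in e]; rewrite (setIidPr Ue) => ->.
  by rewrite cardsE (card_uniqP e_uniq) size_tuple.
pose J := [set j | tnth e j \notin U].
have := @marginal_le2 J (fun j => f (tnth e j)).
rewrite card_fixed_positions // => /(_ U2) muJ.
have muU x : \sum_(h | map_tuple (resample U f h) e == x)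
      mu (map_tuple (resample U f h) e) * #|G|%:R ^+ #|U|
    = if [forall j in J, tnth x j == f (tnth e j)]
      then mu x * (#|G| ^ #|V|)%:R else 0.
  rewrite (eq_bigr (fun=> mu x * #|G|%:R ^+ #|U|)) => [|h /eqP -> //].
  transitivity (mu x *
      (#|[set h | map_tuple (resample U f h) e == x]| * #|G| ^ #|U|)%:R).
    rewrite -big_set sumr_const -[LHS]mulr_natr natrM natrX; ring.
  by rewrite card_resample_eq //; case: ifP; rewrite ?mulr0.
have sumU : (\sum_h mu (map_tuple (resample U f h) e)) * #|G|%:R ^+ #|U|
    = prob mu (fun x => [forall j in J, tnth x j == f (tnth e j)])
      * (#|G| ^ #|V|)%:R.
  rewrite mulr_suml.
  rewrite (partition_big (fun h => map_tuple (resample U f h) e) predT) //=.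
  rewrite /prob mulr_suml [RHS]big_mkcond /=; apply: eq_bigr => x _.
  exact: muU.
have -> : #|G|%:R ^+ k
    = #|G|%:R ^+ #|U| * #|G|%:R ^+ #|[set v in e] :\: U| :> R.
  by rewrite -exprD cardk.
by rewrite -mulr_sumr mulrC mulrA sumU mulrAC muJ mul1r.
Qed.

End PairwiseIndependence.

(** * Boundary expansion and the choice of closures *)

Section Expansion.
Variables (R : realType) (l : nat) (k : 'I_l -> nat).
Variables (V : finType) (Phi : csp_instance k V).

Local Notation constraint := 'I_(nb_constraints Phi).
Implicit Types (S : {set V}) (A B D : {set constraint}) (i : constraint).

(* The variables of [i] that cannot be averaged out when peeling [i] off [D]
   while preserving the marginal on [S]. *)
Definition blocked S D i : {set V} := vars i :\: (boundary D :\: S).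

(** Quantifying over every [D] between [A] and [B] lets the property survive the removal of a
    constraint from [B], as induction on the peeling requires. *)
Definition peelable S A B : Prop :=
  forall D, A \proper D -> D \subset B ->
    exists2 i, i \in D :\: A & (#|blocked S D i| <= 2)%N.

Lemma boundary_anti A D i : A \subset D -> i \in A ->
  vars i :&: boundary D \subset boundary A.
Proof.
move=> AD iA; apply/subsetP => v /setIP[vi]; rewrite !inE => /eqP vD.
rewrite eqn_leq -{1}vD subset_leq_card /=.
  by apply/card_gt0P; exists i; rewrite inE iA.
by apply/subsetP => j; rewrite !inE => /andP[/(subsetP AD) -> ->].
Qed.

Lemma blocked_sub S A D i : A \subset D -> i \in A ->
  blocked S A i \subset blocked S D i.
Proof.
move=> AD iA; apply/subsetP => v; rewrite !in_setD => /andP[vA vi].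
rewrite vi andbT; apply: contra vA => /andP[-> vD] /=.
by apply: (subsetP (boundary_anti AD iA)); rewrite inE vi.
Qed.

(** Enlarging a family only adds sharing, so blocked variables stay blocked. Hence the blocked
    incidences of [D :\: A] are bounded by the growth of the total from [A] to [D], which a maximal
    potential controls. *)
Lemma sum_blocked_sub S A D : A \subset D ->
  (\sum_(i in D :\: A) #|blocked S D i| + \sum_(i in A) #|blocked S A i|
    <= \sum_(i in D) #|blocked S D i|)%N.
Proof.
move=> AD; rewrite [leqRHS](big_setID A) /= (setIidPr AD) addnC leq_add2r.
by apply: leq_sum => i iA; apply/subset_leq_card/blocked_sub.
Qed.

Lemma card_boundaryD_le S D :
  (#|boundary D :\: S| <= \sum_(i in D) #|vars i :&: (boundary D :\: S)|)%N.
Proof.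
have sub : boundary D :\: S
    \subset \bigcup_(i in D) (vars i :&: (boundary D :\: S)).
  apply/subsetP => v vD.
  have := vD; rewrite in_setD inE => /andP[_ /cards1P[i Di]].
  have : i \in [set i] by rewrite inE.
  rewrite -{1}Di inE => /andP[iD vi].
  by apply/bigcupP; exists i => //; rewrite in_setI vi.
apply: leq_trans (subset_leq_card sub) _.
elim/big_rec2: _ => [|i m B _ IH]; first by rewrite cards0.
by apply: leq_trans (leq_card_setU _ _) _; rewrite leq_add2l.
Qed.

Variables (s delta : R).
Hypothesis delta_le : delta <= 1 / 4.
Hypothesis Phi_expanding : boundary_expanding Phi s (2 + delta).

(** Each boundary variable outside [S] accounts for an unblocked incidence, so expansion leaves at
    most [(2 + delta) * #|D| + #|S|] blocked ones; 9/4 comes from [delta <= 1 / 4]. *)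
Lemma sum_blocked_le S D : #|D|%:R <= s ->
  (\sum_(i in D) #|blocked S D i|)%:R <= 9 / 4 * #|D|%:R + #|S|%:R :> R.
Proof.
move=> Ds; have := Phi_expanding Ds; rewrite -natr_sum => exp.
have : (#|boundary D| + \sum_(i in D) #|blocked S D i|
    <= \sum_(i in D) #|vars i| + #|S|)%N.
  have -> : (\sum_(i in D) #|vars i|
    = \sum_(i in D) #|vars i :&: (boundary D :\: S)|
      + \sum_(i in D) #|blocked S D i|)%N.
    by rewrite -big_split; apply: eq_bigr => i _; rewrite /= /blocked cardsID.
  have := card_boundaryD_le S D; have := cardsID S (boundary D).
  have := subset_leq_card (subsetIr (boundary D) S); lia.
rewrite -(ler_nat R) !natrD => le.
have : delta * #|D|%:R <= 1 / 4 * #|D|%:R by rewrite ler_wpM2r ?ler0n.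
move: exp le; rewrite mulrDl; lra.
Qed.

Lemma exists_unblocked S B D : (\sum_(i in B) #|blocked S D i| < 3 * #|B|)%N ->
  exists2 i, i \in B & (#|blocked S D i| <= 2)%N.
Proof.
move=> lt3; apply/exists_inP; apply: contraLR lt3 => /exists_inPn all3.
rewrite -leqNgt mulnC -sum_nat_const; apply: leq_sum => i /all3.
by rewrite -ltnNge.
Qed.

(** For [#|D| >= 2] the average works, as 9/4 [#|D|] + 1 < 3 [#|D|]. This fails for a single
    constraint, but all its variables are boundary, so only those in [S] are blocked. *)
Lemma peelable_small S B : (#|S| <= 1)%N -> #|B|%:R <= s -> peelable S set0 B.
Proof.
move=> S1 Bs D; rewrite proper0 setD0 -card_gt0 => D0 DB.
have [|D1] := leqP #|D| 1.
  rewrite leq_eqVlt ltnS leqn0 (gtn_eqF D0) orbF => /cards1P[i ->].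
  exists i; first by rewrite inE.
  apply: leq_trans (leq_trans S1 _) => //; apply: subset_leq_card.
  apply/subsetP => v; rewrite !inE negb_and negbK => /andP[/orP[//|v1] vi].
  case/negP: v1; apply/cards1P; exists i; apply/setP => j; rewrite !inE.
  by case: eqP => [->|//].
apply: exists_unblocked; rewrite -(ltr_nat R).
have Ds : #|D|%:R <= s by apply: le_trans Bs; rewrite ler_nat subset_leq_card.
apply: le_lt_trans (sum_blocked_le S Ds) _.
have : 2 <= #|D|%:R :> R by rewrite ler_nat.
move: S1; rewrite -(ler_nat R) natrM; lra.
Qed.

(* Maximising the number of blocked incidences minus 5/2 per constraint makes
   any further constraints peelable on average, as 5/2 < 3, while expansion
   with 2 + delta < 5/2 keeps the maximiser small. *)
Lemma exists_closure S : 0 <= s ->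
  exists A, [/\ #|A|%:R <= 4 * #|S|%:R :> R &
    forall B, A \subset B -> #|B|%:R <= s -> peelable S A B].
Proof.
move=> s0.
pose pot D : R :=
  (\sum_(i in D) #|blocked S D i|)%:R - 5 / 2 * #|D|%:R.
have P0 : #|set0 : {set constraint}|%:R <= s by rewrite cards0.
have [A As Amax] : exists2 A : {set constraint}, #|A|%:R <= s &
    forall D : {set constraint}, #|D|%:R <= s -> pot D <= pot A.
  by have [A As Amax] := @Order.TotalTheory.arg_maxP _ _ _ set0
    (fun D => #|D|%:R <= s) pot P0; exists A.
exists A; split.
  (* The empty family has potential 0, so 0 <= [pot A] <= [#|S|] - [#|A|] / 4; this is the source of
     the factor 4. *)
  have := Amax _ P0; rewrite /pot big_set0 cards0 mulr0 subr0.
  have := sum_blocked_le S As; lra.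
move=> B AB Bs D /andP[AD DA] DB.
have Ds : #|D|%:R <= s by apply: le_trans Bs; rewrite ler_nat subset_leq_card.
apply: exists_unblocked; rewrite -(ltr_nat R) natrM.
have := sum_blocked_sub S AD; rewrite -(ler_nat R) natrD.
have := Amax _ Ds; rewrite /pot.
have -> : #|D|%:R = #|D :\: A|%:R + #|A|%:R :> R.
  by rewrite -natrD addnC -(cardsID A D) (setIidPr AD).
have : 0 < #|D :\: A|%:R :> R by rewrite ltr0n card_gt0 setD_eq0.
lra.
Qed.

End Expansion.

(** * Peeling constraints off a weighted sum *)

Section Peeling.
Variables (R : realType) (G : finType) (l : nat) (k : 'I_l -> nat).
Variables (V : finType) (Phi : csp_instance k V).
Variable mu : forall i : 'I_l, (k i).-tuple G -> R.
Hypothesis mu_dist : forall i, is_distribution (@mu i).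
Hypothesis mu_pi : forall i, balanced_pairwise_independent (@mu i).
Hypothesis G_gt0 : (0 < #|G|)%N.

Local Notation constraint := 'I_(nb_constraints Phi).
Implicit Types (f : {ffun V -> G}) (S : {set V}) (A B D : {set constraint}).
Implicit Types (i : constraint) (H : {ffun V -> G} -> R).

Definition density i f : R :=
  #|G|%:R ^+ k (ctype i) * mu (map_tuple f (scope i)).

Definition weight A f : R := \prod_(i in A) density i f.

Lemma density_determined i : determined_by (vars i) (density i).
Proof.
move=> f h fh; congr (_ * mu _); apply: eq_from_tnth => j.
by rewrite !tnth_map fh // tnth_vars.
Qed.

Lemma density_ge0 i f : 0 <= density i f.
Proof. by rewrite mulr_ge0 ?exprn_ge0 ?ler0n //; case: (mu_dist (ctype i)). Qed.

Lemma weight_ge0 A f : 0 <= weight A f.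
Proof. by apply: prodr_ge0 => i _; apply: density_ge0. Qed.

(** Resample the boundary variables of [i] outside [S]: neither [H] nor the other densities of [D]
    read them, and the density of [i] averages to 1. *)
Lemma sum_peel1 S D i H : determined_by S H -> i \in D ->
  (#|blocked S D i| <= 2)%N ->
  \sum_f H f * weight D f = \sum_f H f * weight (D :\ i) f.
Proof.
move=> HS iD i2; pose U := vars i :&: (boundary D :\: S).
have iU : vars i :\: U = blocked S D i by rewrite setDIr setDv set0U.
have inv f h : H (resample U f h) * weight (D :\ i) (resample U f h)
    = H f * weight (D :\ i) f.
  congr (_ * _).
    by apply: HS => v vS; rewrite ffunE !inE vS /= andbF.
  apply: eq_bigr => j; rewrite !inE => /andP[ji jD].
  apply: density_determined => v vj; rewrite ffunE; case: ifP => //.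
  rewrite !inE => /and3P[vi _ /cards1P[i' Di']].
  have : i \in [set i'] by rewrite -Di' !inE iD.
  have : j \in [set i'] by rewrite -Di' !inE jD; rewrite inE in vj.
  by rewrite !inE => /eqP <- /eqP ij; rewrite ij eqxx in ji.
have N0 : (#|G| ^ #|V|)%:R != 0 :> R.
  by rewrite pnatr_eq0 -lt0n expn_gt0 G_gt0.
apply: (mulfI N0); rewrite -(sum_resample U) mulr_sumr; apply: eq_bigr => f _.
transitivity (\sum_h H f * weight (D :\ i) f * density i (resample U f h)).
  apply: eq_bigr => h _; rewrite -(inv f h) -mulrA; congr (_ * _).
  by rewrite /weight (big_setD1 i) //= mulrC.
rewrite -mulr_sumr mulrC; congr (_ * _).
apply: sum_resample_constraint => //; first exact: scope_uniq.
  exact: subsetIl.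
by move: i2; rewrite -iU.
Qed.

Lemma sum_peel S A B H : determined_by S H -> A \subset B -> peelable S A B ->
  \sum_f H f * weight B f = \sum_f H f * weight A f.
Proof.
move=> HS; move: {2}(#|B :\: A|) (erefl #|B :\: A|) => n.
elim: n B => [|n IHn] B BA AB peelB.
  have /eqP := BA; rewrite cards_eq0 setD_eq0 => BA'.
  by have -> : A = B by apply/eqP; rewrite eqEsubset AB.
have pAB : A \proper B.
  rewrite properEneq AB andbT.
  by apply: contraPneq BA => ->; rewrite setDv cards0.
have [i iBA i2] := peelB B pAB (subxx _).
have /setDP[iB iA] := iBA.
rewrite (sum_peel1 HS iB i2); apply: IHn.
- apply: succn_inj; rewrite -BA [RHS](cardsD1 i) iBA add1n; congr (_.+1).
  by apply: eq_card => j; rewrite !inE andbCA.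
- by rewrite subsetD1 AB.
by move=> D AD DB; apply: peelB => //; apply: subset_trans DB (subsetDl _ _).
Qed.

End Peeling.

(** * Marginals of the weighted measures *)

Section LocalSolution.
Variables (R : realType) (G : finType) (l : nat) (k : 'I_l -> nat).
Variables (V : finType) (Phi : csp_instance k V).
Variable mu : forall i : 'I_l, (k i).-tuple G -> R.
Implicit Types (A B : {set 'I_(nb_constraints Phi)}) (S T : {set V}).

Definition restrict S (f : {ffun V -> G}) : partial_assignment G S :=
  [ffun v => f (sval v)].

Lemma restrict_determined (T : Type) S
    (F : partial_assignment G S -> T) :
  determined_by S (fun f => F (restrict S f)).
Proof.
by move=> f h fh; congr F; apply/ffunP => -[v vS]; rewrite !ffunE /= fh.
Qed.

Lemma restrict_glue S T (f : {ffun V -> G})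
    (alpha : partial_assignment G S) (beta : partial_assignment G (T :\: S)) :
  S \subset T ->
  (restrict T f == glue alpha beta)
    = (restrict S f == alpha) && (restrict (T :\: S) f == beta).
Proof.
move=> /subsetP ST; apply/eqP/andP => [fT|[/eqP <- /eqP <-]]; last first.
  apply/ffunP => -[v vT]; rewrite !ffunE /=.
  by destruct (boolP (v \in S)); rewrite ffunE.
split; apply/eqP/ffunP => -[v vS]; rewrite ffunE /=.
  have := congr1 (fun a : partial_assignment G T => a (exist _ v (ST v vS))) fT.
  rewrite !ffunE /=; destruct (boolP (v \in S)) as [vS'|vS'];
    last by case/negP: vS'.
  by rewrite (bool_irrelevance vS' vS).
have /setDP[vT vS'] := vS.
have := congr1 (fun a : partial_assignment G T => a (exist _ v vT)) fT.
rewrite !ffunE /=; destruct (boolP (v \in S)) as [vS''|vS''];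
  first by case/negP: vS'.
by rewrite (bool_irrelevance (in_setD_intro _ _) vS).
Qed.

Lemma scope_values_restrict i (f : {ffun V -> G}) :
  scope_values (restrict (vars i) f) = map_tuple f (scope i : _.-tuple V)
    :> (k (ctype (c := Phi) i)).-tuple G.
Proof. by apply: eq_from_tnth => j; rewrite tnth_mktuple tnth_map ffunE. Qed.

(* The marginal on [S] of the measure on total assignments whose density
   against the uniform distribution is [weight mu A]. *)
Definition marginal A S
    (alpha : partial_assignment G S) : R :=
  (#|G| ^ #|V|)%:R^-1 *
    \sum_f (restrict S f == alpha)%:R * weight mu A f.

(** Every total assignment extending [alpha] matches exactly one [beta], its own restriction.
    Consistency is thus immediate for a fixed [A]; the difficulty is that [A] will vary with the
    set. *)
Lemma sum_marginal_glue A S T (alpha : partial_assignment G S) :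
  S \subset T ->
  \sum_(beta : partial_assignment G (T :\: S)) marginal A (glue alpha beta)
    = marginal A alpha.
Proof.
move=> ST; rewrite -mulr_sumr exchange_big; congr (_ * _) => /=.
apply: eq_bigr => f _; rewrite -mulr_suml; congr (_ * _).
rewrite (bigD1 (restrict (T :\: S) f)) //= big1 => [|beta bf].
  by rewrite restrict_glue // eqxx andbT addr0.
by rewrite restrict_glue // [X in _ && X]eq_sym (negbTE bf) andbF.
Qed.

Hypothesis mu_dist : forall i, is_distribution (@mu i).
Hypothesis mu_pi : forall i, balanced_pairwise_independent (@mu i).
Hypothesis G_gt0 : (0 < #|G|)%N.

Lemma marginal_peel A B S (alpha : partial_assignment G S) :
  A \subset B -> peelable S A B -> marginal B alpha = marginal A alpha.
Proof.
move=> AB peelB; congr (_ * _).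
apply: (sum_peel mu_dist mu_pi G_gt0 _ AB peelB).
exact: (@restrict_determined _ S (fun a => (a == alpha)%:R)).
Qed.

Lemma marginal_set0 A (alpha : partial_assignment G set0) :
  peelable set0 set0 A -> marginal A alpha = 1.
Proof.
move=> peelA; rewrite (marginal_peel _ (sub0set A) peelA) /marginal.
rewrite (eq_bigr (fun=> 1)) => [|f _].
  by rewrite sumr_const card_ffun mulVf // pnatr_eq0 -lt0n expn_gt0 G_gt0.
rewrite /weight big_set0 mulr1; have -> : restrict set0 f = alpha.
  by apply/ffunP => -[v v0]; have := v0; rewrite inE.
by rewrite eqxx.
Qed.

Lemma marginal_set1 A (v : V) (g : G) :
  peelable [set v] set0 A ->
  marginal A ([ffun=> g] : partial_assignment G [set v]) = #|G|%:R^-1.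
Proof.
move=> peelA; rewrite (marginal_peel _ (sub0set A) peelA) /marginal.
have N0 : #|G|%:R != 0 :> R by rewrite pnatr_eq0 -lt0n.
have NV0 : (#|G| ^ #|V|)%:R != 0 :> R by rewrite pnatr_eq0 -lt0n expn_gt0 G_gt0.
apply: (mulIf N0); rewrite mulVf //; apply: (mulfI NV0).
rewrite !mulrA mulfV // mul1r mulr1.
have /(congr1 (fun n => n%:R : R)) := card_agree [set v] [ffun=> g].
rewrite cards1 expn1 natrM => <-; congr (_ * _).
rewrite -sum1_card natr_sum [RHS]big_mkcond /=; apply: eq_bigr => f _.
rewrite /weight big_set0 mulr1 inE.
have -> : (restrict [set v] f == [ffun=> g])
    = [forall w in [set v], f w == ([ffun=> g] : {ffun V -> G}) w].
  apply/eqP/forall_inP => [fg w wv|fg].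
    have := congr1
      (fun a : partial_assignment G [set v] => a (exist _ w wv)) fg.
    by rewrite !ffunE => ->.
  by apply/ffunP => -[w wv]; have/eqP := fg w wv; rewrite !ffunE.
by case: ifP.
Qed.

Lemma marginal_ge0 A S (alpha : partial_assignment G S) :
  0 <= marginal A alpha.
Proof.
rewrite mulr_ge0 ?invr_ge0 ?ler0n //; apply: sumr_ge0 => f _.
by rewrite mulr_ge0 ?ler0n ?(weight_ge0 mu_dist).
Qed.

(** The marginal on [set0] is the total mass, which bounds every other marginal. *)
Lemma marginal_le1 A S (alpha : partial_assignment G S) :
  peelable set0 set0 A -> marginal A alpha <= 1.
Proof.
have [g _] := card_gt0P G_gt0.
move=> peelA; rewrite -(marginal_set0 [ffun=> g] peelA).
rewrite ler_wpM2l ?invr_ge0 ?ler0n //; apply: ler_sum => f _.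
rewrite ler_wpM2r ?(weight_ge0 mu_dist) //.
have -> : restrict set0 f = [ffun=> g].
  by apply/ffunP => -[v v0]; have := v0; rewrite inE.
by rewrite eqxx lern1 leq_b1.
Qed.

Lemma marginal_unsupported A (P : forall i, {set (k i).-tuple G}) i
    (alpha : partial_assignment G (vars i)) :
  (forall i, supports (P i) (@mu i)) -> i \in A ->
  scope_values alpha \notin P (ctype i) -> marginal A alpha = 0.
Proof.
move=> Pmu iA aP; rewrite /marginal big1 ?mulr0 // => f _.
case: eqP => [fa|]; last by rewrite mul0r.
rewrite /weight (bigD1 i) //= /density -scope_values_restrict fa.
by rewrite (Pmu _ _ aP) mulr0 mul0r mulr0.
Qed.

End LocalSolution.

(** * Arity bounds and assembly of the Sherali-Adams solution *)

Lemma bigminn_le_seq (I : eqType) (r : seq I) (F : I -> nat) (x : nat) (i : I) :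
  i \in r -> (\big[minn/x]_(j <- r) F j <= F i)%N.
Proof.
elim: r => // j r IHr; rewrite inE big_cons geq_min => /orP[/eqP ->|/IHr ->].
  by rewrite leqnn.
by rewrite orbT.
Qed.

Lemma k_min_le (l : nat) (k : 'I_l -> nat) (i : 'I_l) : (k_min k <= k i)%N.
Proof. by apply: bigminn_le_seq; rewrite mem_index_enum. Qed.

Theorem theorem4 (R : realType) (G : finType) (l : nat) (k : 'I_l -> nat)
    (P : forall i : 'I_l, {set (k i).-tuple G})
    (l_gt0 : (0 < l)%N)
    (k_min_ge3 : (3 <= k_min k)%N)
    (P_supports : forall i : 'I_l, exists mu : (k i).-tuple G -> R,
       [/\ is_distribution mu, balanced_pairwise_independent mu
         & supports (P i) mu])
    (V : finType) (Phi : csp_instance k V)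
    (s delta : R)
    (delta_gt0 : 0 < delta) (delta_le : delta <= 1 / 4)
    (Phi_expanding : boundary_expanding Phi s (2 + delta)) :
  let t := delta * s / (6 * (k_max k)%:R) in
  exists X : local_family R G V,
    [/\ local_distribution t X,
        balanced_solution t X
      & forall i : 'I_(nb_constraints Phi), satisfies_constraint P t X i].
Proof.
move=> t.
have k_ge3 i : (3 <= k i)%N by apply: leq_trans k_min_ge3 (k_min_le k i).
have kmax_ge1 : 1 <= (k_max k)%:R :> R.
  rewrite ler1n; have i0 := Ordinal l_gt0.
  by apply: leq_trans (leq_bigmax i0); apply: leq_trans (k_ge3 i0).
(* For negative [s] no set has size at most [t]; the constant 1 meets the condition at [set0], which
   carries no size bound. *)
have [s0|s_lt0] := leP 0 s; last first.
  have t_lt0 : t < 0.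
    rewrite ltr_pdivrMr ?mul0r; last lra.
    by rewrite pmulr_rlt0.
  have noset (S : {set V}) : #|S|%:R <= t -> False.
    by move=> St; have := le_lt_trans St t_lt0; rewrite ltrn0.
  exists (fun _ _ => 1); split=> [|v /noset //|i /noset //].
  by split=> [S alpha /noset //|//|S T alpha _ /noset //].
(* 24 is 6 * 4, from [delta <= 1 / 4] and [k_max k >= 1]. It leaves room for the families used
   below, of sizes at most 8 [t]. *)
have t_le : 24 * t <= s.
  rewrite /t mulrA ler_pdivrMr; last lra.
  have : delta * s <= 1 / 4 * s by rewrite ler_wpM2r.
  have : s <= (k_max k)%:R * s by rewrite ler_peMl.
  lra.
pose mu i := sval (cid (P_supports i)).
have mu_dist i : is_distribution (@mu i) by case: (svalP (cid (P_supports i))).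
have mu_pi i : balanced_pairwise_independent (@mu i).
  by case: (svalP (cid (P_supports i))).
have mu_P i : supports (P i) (@mu i) by case: (svalP (cid (P_supports i))).
(* Over an empty [G] there would be no tuple of positive length to carry mass 1. *)
have G_gt0 : (0 < #|G|)%N.
  have [_ sum1] := mu_dist (Ordinal l_gt0).
  rewrite lt0n; apply: contra_eq_neq sum1 => G0.
  rewrite big_pred0 1?eq_sym ?oner_neq0 // => x.
  have := fintype0 (tnth x (Ordinal (ltn_trans (ltn0Sn 1) (k_ge3 _)))).
  by move/(_ G0).
pose cl S := sval (cid (exists_closure delta_le Phi_expanding S s0)).
have cl_small S : #|cl S|%:R <= 4 * #|S|%:R :> R.
  by case: (svalP (cid (exists_closure delta_le Phi_expanding S s0))).
have cl_peel S (B : {set 'I_(nb_constraints Phi)}) : cl S \subset B ->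
    #|B|%:R <= s -> peelable S (cl S) B.
  case: (svalP (cid (exists_closure delta_le Phi_expanding S s0))) => _.
  exact.
have cl_marginal S (B : {set 'I_(nb_constraints Phi)})
    (alpha : partial_assignment G S) : cl S \subset B ->
    #|B|%:R <= s -> marginal mu B alpha = marginal mu (cl S) alpha.
  by move=> SB Bs; apply: marginal_peel => //; apply: cl_peel.
(* The bound by 1 and the balance condition need a closure peeled all the way to the empty family,
   that is, to the uniform measure. *)
have small_peel (S S' : {set V}) : (#|S'| <= 1)%N -> #|S|%:R <= t ->
    peelable S' set0 (cl S).
  move=> S'1 St; apply: (peelable_small delta_le Phi_expanding) => //.
  by have := cl_small S; have := ler0n R #|S|; lra.
exists (fun S alpha => marginal mu (cl S) alpha); split; first split.
- move=> S alpha St; rewrite marginal_ge0 //=.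
  by apply: marginal_le1 => //; apply: small_peel; rewrite ?cards0.
- move=> alpha; apply: marginal_set0 => //.
  apply: (peelable_small delta_le Phi_expanding); rewrite ?cards0 //.
  by apply: le_trans (cl_small _) _; rewrite cards0 mulr0.
- move=> S T alpha ST Tt; rewrite sum_marginal_glue //.
  have STr : #|S|%:R <= #|T|%:R :> R by rewrite ler_nat subset_leq_card.
  (* Each closure has at most 4 [t] constraints, so the union has at most 8 [t] and peels down to
     either one. *)
  have Us : #|cl S :|: cl T|%:R <= s.
    have := (leq_card_setU (cl S) (cl T)).1; rewrite -(ler_nat R) natrD.
    have := cl_small S; have := cl_small T; have := ler0n R #|T|; lra.
  rewrite -(cl_marginal _ _ alpha (subsetUl _ _) Us).
  rewrite -(sum_marginal_glue _ _ alpha ST) -(sum_marginal_glue _ _ alpha ST).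
  by apply: eq_bigr => beta _; rewrite (cl_marginal _ _ _ (subsetUr _ _) Us).
- move=> v vt g; apply: marginal_set1 => //.
  by apply: small_peel vt; rewrite cards1.
move=> i it alpha aP.
(* The closure of [vars i] may omit [i]; adding [i] keeps the marginal and brings in the density
   that vanishes off [P]. *)
rewrite -(cl_marginal _ (i |: cl (vars i))) ?subsetUr //.
  by apply: (marginal_unsupported mu_P) aP; rewrite setU11.
(* This absorbs the extra constraint: 4 [#|vars i|] + 1 <= 5 [t] <= [s]. *)
have i1 : 1 <= #|vars i|%:R :> R.
  rewrite ler1n cardsE (card_uniqP (scope_uniq i)) size_tuple.
  exact: leq_trans (k_ge3 _).
have := (leq_card_setU [set i] (cl (vars i))).1.
rewrite cards1 -(ler_nat R) natrD.
have := cl_small (vars i); lra.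
Qed.
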